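(* Let $\mathbb{R}^6$ have coordinates $(x_1,y_1,x_2,y_2,x_3,y_3)$, with indices of $x_i,y_i$ taken modulo $3$, and let $\mathcal{D}_A$ be the distribution spanned by the vector fields $$Z_i=(x_{i+1}-x_i)\,\partial_{x_i}+(y_{i+1}-y_i)\,\partial_{y_i},\qquad i=1,2,3.$$ Then $\mathcal{D}_A$ has growth vector $(3,6)$ at every point of $\mathbb{R}^6$ except at the points for which the three points $(x_1,y_1),(x_2,y_2),(x_3,y_3)$ of the plane lie on a common line, i.e. except at the points where $\sum_{i=1}^3 (y_ix_{i+1}-x_iy_{i+1})=0$.
   Context: A point of $\mathbb{R}^6$ encodes three points (''ants'') $\vec r_i=(x_i,y_i)$, $i=1,2,3$, in the plane. The distribution $\mathcal{D}_A$ is the velocity distribution of the rule ''the velocity $\dot{\vec r}_i$ is aligned with $\vec r_{i+1}-\vec r_i$'' (Rule A). For a distribution $\mathcal{D}$ put $\mathcal{D}^0=\mathcal{D}$ and $\mathcal{D}^{I+1}=[\mathcal{D}^I,\mathcal{D}^I]+\mathcal{D}^I$, where $[\mathcal{D}^I,\mathcal{D}^I]$ consists of all linear combinations, with functional coefficients, of commutators of vector fields belonging to $\mathcal{D}^I$. The growth vector of $\mathcal{D}$ at a point is $(r_0,r_1,\dots,r_K)$ where $r_I$ is the dimension of $\mathcal{D}^I$ at that point (listed until it stabilizes). *)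

(* Defs.v *)
From HB Require Import structures.
From mathcomp Require Import all_boot all_order all_algebra.
From mathcomp Require Import all_classical all_reals all_analysis.

Set Implicit Arguments.
Unset Strict Implicit.
Unset Printing Implicit Defensive.

Import Order.TTheory GRing.Theory Num.Theory.
Import numFieldNormedType.Exports.

Local Open Scope classical_set_scope.
Local Open Scope ring_scope.

Section Distributions.
Variables (R : realType) (n : nat).

Notation point := 'rV[R]_n.+1.
Notation vfield := (point -> point).

Definition partial (i : 'I_n.+1) (f : point -> R) : point -> R :=
  fun p => 'D_(delta_mx 0 i) f p.

Fixpoint Ck (k : nat) (f : point -> R) : Prop :=
  if k is k'.+1 then
    continuous f /\
    forall i, (forall p, derivable f p (delta_mx 0 i)) /\ Ck k' (partial i f)
  else continuous f.

Definition smooth (f : point -> R) : Prop := forall k, Ck k f.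

Definition coef (X : vfield) (j : 'I_n.+1) : point -> R := fun p => X p 0 j.

Definition lie_bracket (X Y : vfield) : vfield := fun p =>
  \row_j \sum_i (X p 0 i * partial i (coef Y j) p
                 - Y p 0 i * partial i (coef X j) p).

(* A distribution is represented by the set of vector fields belonging to it,
   a module over the ring of smooth functions. *)
Definition smooth_span (S : set vfield) : set vfield :=
  [set X | exists (m : nat) (c : 'I_m -> point -> R) (V : 'I_m -> vfield),
     [/\ forall k, smooth (c k),
         forall k, S (V k) &
         X = (fun p => \sum_(k < m) c k p *: V k p)]].

Definition commutators (D : set vfield) : set vfield :=
  [set Z | exists X Y, [/\ D X, D Y & Z = lie_bracket X Y]].

Definition derived_distr (D : set vfield) : set vfield :=
  [set Z | exists X Y, [/\ smooth_span (commutators D) X, D Y &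
                           Z = (fun p => X p + Y p)]].

Definition derived_flag (D : set vfield) (I : nat) : set vfield :=
  iter I derived_distr D.

Definition dim_at (D : set vfield) (p : point) (r : nat) : Prop :=
  exists U : {vspace point},
    (forall v, v \in U <-> exists2 X, D X & X p = v) /\ \dim U = r.

Definition stable_from (r : nat -> nat) (K : nat) : Prop :=
  forall I, (K <= I)%N -> r I = r K.

(* The list stops at the least K from which the dimensions are constant. *)
Definition growth_vector (D : set vfield) (p : point) (s : seq nat) : Prop :=
  exists (r : nat -> nat) (K : nat),
    [/\ forall I, dim_at (derived_flag D I) p (r I),
        stable_from r K,
        forall J, stable_from r J -> (K <= J)%N &
        s = mkseq r K.+1].

End Distributions.

Section Ants.
Variable R : realType.

(* Coordinates are ordered as (x_1, y_1, x_2, y_2, x_3, y_3); the ants are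
   indexed from 0, and ordS i is i + 1 modulo 3. *)
Definition xpos (i : 'I_3) : 'I_6 := inord i.*2.
Definition ypos (i : 'I_3) : 'I_6 := inord i.*2.+1.

Definition xcoord (p : 'rV[R]_6) (i : 'I_3) : R := p 0 (xpos i).
Definition ycoord (p : 'rV[R]_6) (i : 'I_3) : R := p 0 (ypos i).

Definition Zfield (i : 'I_3) (p : 'rV[R]_6) : 'rV[R]_6 :=
  (xcoord p (ordS i) - xcoord p i) *: delta_mx 0 (xpos i)
  + (ycoord p (ordS i) - ycoord p i) *: delta_mx 0 (ypos i).

Definition D_A : set ('rV[R]_6 -> 'rV[R]_6) := smooth_span (range Zfield).

Definition collinear (p : 'rV[R]_6) : Prop :=
  exists a b c : R,
    (a != 0 \/ b != 0) /\ forall i, a * xcoord p i + b * ycoord p i = c.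

End Ants.

Arguments D_A R : clear implicits.

(* Main.v *)
(** Write [r_i] for the position of ant [i].  The fields [Z_i] are linear, and
    [[Z_i, Z_(i+1)] = - (r_(i+2) - r_(i+1)) . d/dr_i].  Off the collinear locus
    the vectors [r_(i+1) - r_i] and [r_(i+2) - r_(i+1)] form a basis of the
    plane of ant [i], so the [Z_i] and these brackets span the tangent space.
    If all ants lie on a line with normal [(a, b)], the Leibniz rule shows that
    every bracket of two fields of [D_A] is annihilated at that point by
    [a dx_i + b dy_i], as is every field of [D_A]; hence [D^1] is not full. *)

Require Import Defs.
From HB Require Import structures.
From mathcomp Require Import all_boot all_order all_algebra.
From mathcomp Require Import all_classical all_reals all_analysis.
From mathcomp Require Import ring lra.

Import Order.TTheory GRing.Theory Num.Theory.
Import numFieldNormedType.Exports.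
Local Open Scope classical_set_scope.
Local Open Scope ring_scope.

(** * Brackets of linear fields, and spans with smooth coefficients *)

Section VectorFields.
Context {R : realType} {n : nat}.
Notation point := 'rV[R]_n.+1.
Implicit Types (p v : point) (X Y : point -> point) (D : set (point -> point)).

Lemma linear_row_coords (V : lmodType R) (f : point -> V) v :
  linear f -> f v = \sum_j v 0 j *: f (delta_mx 0 j).
Proof.
move=> fL.
pose g : {linear point -> V} := HB.pack f (GRing.isLinear.Build _ _ _ _ f fL).
rewrite -[f]/(g : _ -> _) {1}(row_sum_delta v) linear_sum.
by apply: eq_bigr => j _; rewrite linearZ.
Qed.

(** By linearity the difference quotient equals [f v] for every [h] other than 0. *)
Lemma is_derive_linear (f : point -> R) p v :
  linear (f : point -> R^o) -> is_derive p v (f : point -> R^o) (f v).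
Proof.
move=> fL.
have cvf : h^-1 *: ((f (h *: v + p) : R^o) - f p) @[h --> (0 : R)^'] -->
    (f v : R^o).
  apply: cvg_near_cst; near=> h.
  rewrite fL addrK scalerA mulVf ?scale1r//.
  by near: h; exact: nbhs_dnbhs_neq.
split; first by apply/cvg_ex; exists (f v).
exact: cvg_lim cvf.
Unshelve. all: by end_near. Qed.

(** The partial derivatives of a linear field are its matrix entries, so the bracket reduces to a
    commutator of linear maps. *)
Lemma lie_bracket_linear X Y p :
  linear X -> linear Y -> lie_bracket X Y p = Y (X p) - X (Y p).
Proof.
have dcoef Z j i : linear Z -> partial i (coef Z j) p = Z (delta_mx 0 i) 0 j.
  move=> ZL; rewrite /partial.
  have /is_derive_linear H : linear (coef Z j : point -> R^o).
    by move=> k u w; rewrite /coef ZL !mxE.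
  by have /@derive_val := H p (delta_mx 0 i).
move=> XL YL; apply/rowP => j; rewrite !mxE sumrB.
rewrite [in RHS](linear_row_coords _ _ (X p) YL).
rewrite [in RHS](linear_row_coords _ _ (Y p) XL) !summxE.
by congr (_ - _); apply: eq_bigr => i _; rewrite dcoef// !mxE.
Qed.

Lemma smooth_cst (c : R) : smooth (fun _ : point => c).
Proof.
move=> k; elim: k c => [|k IHk] c /=; first exact: cst_continuous.
split; first exact: cst_continuous.
move=> i; split; first by move=> p; exact: derivable_cst.
rewrite (_ : partial _ _ = fun=> 0) //.
by apply/funext => p; exact: derive_cst.
Qed.

Lemma smooth_derivable (f : point -> R) p i :
  smooth f -> derivable f p (delta_mx 0 i).
Proof. by move=> /(_ 1%N) /= [_ /(_ i) []]. Qed.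

(** Constant coefficients are enough to realise any prescribed value at a single point. *)
Lemma smooth_span_cst {D} m (c : 'I_m -> R) (V : 'I_m -> point -> point) :
  (forall k, D (V k)) -> smooth_span D (fun p => \sum_k c k *: V k p).
Proof.
by move=> DV; exists m, (fun k _ => c k), V; split=> // k; exact: smooth_cst.
Qed.

Lemma smooth_span_at D (U : {vspace point}) p :
  (forall X, D X -> X p \in U) -> forall X, smooth_span D X -> X p \in U.
Proof.
move=> DU X [m [c [V [_ DV ->]]]].
by apply: memv_suml => k _; rewrite memvZ// DU.
Qed.

Lemma derived_distr_sub D : D `<=` derived_distr D.
Proof.
move=> X DX; exists (fun=> 0), X; split=> //; last first.
  by apply/funext => p; rewrite add0r.
(* The bracket summand is the empty combination. *)
exists 0%N, (fun _ _ => 0), (fun _ _ => 0); split=> [[]//|[]//|].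
by apply/funext => p; rewrite big_ord0.
Qed.

Lemma derived_flag1_sub D I : derived_flag D 1 `<=` derived_flag D I.+1.
Proof.
by elim: I => // I IHI X /IHI; exact: derived_distr_sub.
Qed.

End VectorFields.

(** * The fields of Rule A and their brackets, ant by ant *)

Section Ants.
Context {R : realType}.
Implicit Types (p q v : 'rV[R]_6) (i k : 'I_3).

Lemma eq_xpos i k : (xpos i == xpos k) = (i == k).
Proof.
apply/eqP/eqP => [|->//]; move: i k; do 2 case=> [[|[|[|]]]] //= ?.
all: by move/(congr1 val); rewrite /= !inordK// => _; apply/val_inj.
Qed.

Lemma eq_ypos i k : (ypos i == ypos k) = (i == k).
Proof.
apply/eqP/eqP => [|->//]; move: i k; do 2 case=> [[|[|[|]]]] //= ?.
all: by move/(congr1 val); rewrite /= !inordK// => _; apply/val_inj.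
Qed.

Lemma neq_xypos i k : (xpos i == ypos k) = false.
Proof.
apply/eqP; move: i k; do 2 case=> [[|[|[|]]]] //= ?.
all: by move/(congr1 val); rewrite /= !inordK.
Qed.

Lemma xyposP (j : 'I_6) : exists i, j = xpos i \/ j = ypos i.
Proof.
exists (inord j./2); move: j.
by case=> [[|[|[|[|[|[|]]]]]]] //= ?; [left|right|left|right|left|right];
  apply/val_inj; rewrite /= !inordK // inordK.
Qed.

Lemma ordS3_neq i : (ordS i == i) = false.
Proof. by apply/eqP; case: i => [[|[|[|]]]] //= ? /(congr1 val). Qed.

Lemma ordSS3_neq i : (ordS (ordS i) == i) = false.
Proof. by apply/eqP; case: i => [[|[|[|]]]] //= ? /(congr1 val). Qed.

Lemma coord_ext p q :
  (forall i, xcoord p i = xcoord q i) -> (forall i, ycoord p i = ycoord q i) ->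
  p = q.
Proof.
move=> px py; apply/rowP => j.
by have [i [->|->]] := xyposP j; [exact: px|exact: py].
Qed.

Lemma xcoordD p q i : xcoord (p + q) i = xcoord p i + xcoord q i.
Proof. by rewrite /xcoord mxE. Qed.

Lemma ycoordD p q i : ycoord (p + q) i = ycoord p i + ycoord q i.
Proof. by rewrite /ycoord mxE. Qed.

Lemma xcoordB p q i : xcoord (p - q) i = xcoord p i - xcoord q i.
Proof. by rewrite /xcoord !mxE. Qed.

Lemma ycoordB p q i : ycoord (p - q) i = ycoord p i - ycoord q i.
Proof. by rewrite /ycoord !mxE. Qed.

Lemma xcoordZ (c : R) p i : xcoord (c *: p) i = c * xcoord p i.
Proof. by rewrite /xcoord mxE. Qed.

Lemma ycoordZ (c : R) p i : ycoord (c *: p) i = c * ycoord p i.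
Proof. by rewrite /ycoord mxE. Qed.

Lemma xcoord_sum m (F : 'I_m -> 'rV[R]_6) i :
  xcoord (\sum_k F k) i = \sum_k xcoord (F k) i.
Proof. by rewrite /xcoord summxE. Qed.

Lemma ycoord_sum m (F : 'I_m -> 'rV[R]_6) i :
  ycoord (\sum_k F k) i = \sum_k ycoord (F k) i.
Proof. by rewrite /ycoord summxE. Qed.

Lemma xcoord_Zfield k p i :
  xcoord (Zfield k p) i = (i == k)%:R * (xcoord p (ordS i) - xcoord p i).
Proof.
rewrite {1}/xcoord !mxE eq_xpos neq_xypos eqxx /= mulr0 addr0 mulrC.
by case: eqP => [->//|]; rewrite !mul0r.
Qed.

Lemma ycoord_Zfield k p i :
  ycoord (Zfield k p) i = (i == k)%:R * (ycoord p (ordS i) - ycoord p i).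
Proof.
rewrite {1}/ycoord !mxE eq_ypos (eq_sym (ypos i)) neq_xypos eqxx /=.
by rewrite mulr0 add0r mulrC; case: eqP => [->//|]; rewrite !mul0r.
Qed.

Lemma Zfield_linear k : linear (@Zfield R k).
Proof.
move=> c u v; apply: coord_ext => i.
  by rewrite [RHS]xcoordD xcoordZ !xcoord_Zfield !xcoordD !xcoordZ; ring.
by rewrite [RHS]ycoordD ycoordZ !ycoord_Zfield !ycoordD !ycoordZ; ring.
Qed.

(** Only ant [k] gets a component: [Zfield k] depends on ant [ordS k], which [Zfield (ordS k)]
    moves, while [Zfield (ordS k)] does not depend on ant [k]. *)
Lemma xcoord_lie_Zfield k p i :
  xcoord (lie_bracket (Zfield k) (Zfield (ordS k)) p) i =
  (i == k)%:R * (xcoord p (ordS i) - xcoord p (ordS (ordS i))).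
Proof.
rewrite lie_bracket_linear; try exact: Zfield_linear.
rewrite xcoordB !xcoord_Zfield (inj_eq (@ordS_inj 3)).
have [->|_] := eqVneq i k.
  by rewrite [k == ordS k]eq_sym ordS3_neq /=; ring.
have [->|_] := eqVneq i (ordS k); last by rewrite /=; ring.
by rewrite ordSS3_neq /=; ring.
Qed.

Lemma ycoord_lie_Zfield k p i :
  ycoord (lie_bracket (Zfield k) (Zfield (ordS k)) p) i =
  (i == k)%:R * (ycoord p (ordS i) - ycoord p (ordS (ordS i))).
Proof.
rewrite lie_bracket_linear; try exact: Zfield_linear.
rewrite ycoordB !ycoord_Zfield (inj_eq (@ordS_inj 3)).
have [->|_] := eqVneq i k.
  by rewrite [k == ordS k]eq_sym ordS3_neq /=; ring.
have [->|_] := eqVneq i (ordS k); last by rewrite /=; ring.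
by rewrite ordSS3_neq /=; ring.
Qed.

Lemma D_A_Zfield k : D_A R (Zfield k).
Proof.
rewrite (_ : Zfield k = fun p => \sum_(l < 1) 1 *: Zfield k p).
  by apply: smooth_span_cst => _; exists k.
by apply/funext => p; rewrite big_ord1 scale1r.
Qed.

(** * Collinearity as the vanishing of a determinant *)

(* Minus twice the usual signed area of the triangle of ants; by [area2E] it
   does not depend on [i]. *)
Definition area2 p i : R :=
  (ycoord p (ordS i) - ycoord p i)
    * (xcoord p (ordS (ordS i)) - xcoord p (ordS i))
  - (xcoord p (ordS i) - xcoord p i)
    * (ycoord p (ordS (ordS i)) - ycoord p (ordS i)).

Lemma ordSSS3 i : ordS (ordS (ordS i)) = i.
Proof. by apply/val_inj; case: i => [[|[|[|]]]]. Qed.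

Lemma sum_ordS3 (V : zmodType) (F : 'I_3 -> V) i :
  \sum_k F k = F i + F (ordS i) + F (ordS (ordS i)).
Proof.
rewrite (bigD1 i)//= (bigD1 (ordS i)) ?ordS3_neq//=.
rewrite (bigD1 (ordS (ordS i))) ?ordS3_neq ?ordSS3_neq//= big1 ?addr0 ?addrA//.
move: i; case=> [[|[|[|]]]] // ?; case=> [[|[|[|]]]] // ?.
Qed.

Lemma area2E p i :
  \sum_(k < 3) (ycoord p k * xcoord p (ordS k)
                - xcoord p k * ycoord p (ordS k)) = area2 p i.
Proof. by rewrite (sum_ordS3 _ _ i) ordSSS3 /area2; ring. Qed.

Lemma forall_ordS3 (P : 'I_3 -> Prop) i :
  P i -> P (ordS i) -> P (ordS (ordS i)) -> forall k, P k.
Proof.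
move=> P0 P1 P2 k.
have [->//|ki] := eqVneq k i.
have [->//|kSi] := eqVneq k (ordS i).
rewrite (_ : k = ordS (ordS i))//; apply/val_inj; move: ki kSi.
by move: i k {P0 P1 P2}; do 2 case=> [[|[|[|]]]] //= ?.
Qed.

Lemma collinear_area2 p i : collinear p <-> area2 p i = 0.
Proof.
rewrite /area2; set dx := xcoord p (ordS i) - _; set dy := ycoord p (ordS i) - _.
set ex := xcoord p (ordS (ordS i)) - _; set ey := ycoord p (ordS (ordS i)) - _.
split=> [[a [b [c [ab0 L]]]]|A0].
  have := L i; have := L (ordS i); have := L (ordS (ordS i)) => L2 L1 L0.
  have Ld : a * dx + b * dy = 0 by rewrite /dx /dy; lra.
  have Le : a * ex + b * ey = 0 by rewrite /ex /ey; lra.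
  (* Both edges are orthogonal to the normal [(a, b)]; eliminating [b], then [a], shows that each of
     them kills the determinant. *)
  have aA : a * (dy * ex - dx * ey) = 0.
    transitivity (dy * (a * ex + b * ey) - ey * (a * dx + b * dy)).
      by ring.
    by rewrite Ld Le; ring.
  have bA : b * (dy * ex - dx * ey) = 0.
    transitivity (ex * (a * dx + b * dy) - dx * (a * ex + b * ey)).
      by ring.
    by rewrite Ld Le; ring.
  by case: ab0 => /negPf x0; apply/eqP; [move/eqP: aA|move/eqP: bA];
    rewrite mulf_eq0 x0.
have line a b : (a != 0 \/ b != 0) -> a * dx + b * dy = 0 ->
    a * ex + b * ey = 0 -> collinear p.
  move=> ab0 Ld Le; exists a, b, (a * xcoord p i + b * ycoord p i).
  split=> //; apply: (forall_ordS3 _ i) => //.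
    by move: Ld; rewrite /dx /dy; lra.
  by move: Ld Le; rewrite /dx /dy /ex /ey; lra.
(* A nonzero edge, turned by a right angle, is a normal of the line: first [(dx, dy)] is tried, then
   [(ex, ey)]. If both vanish the ants coincide and any normal will do. *)
have [dx0|dx0] := eqVneq dx 0; last first.
  by apply: (line dy (- dx)); [right; rewrite oppr_eq0|ring|rewrite mulNr].
have [dy0|dy0] := eqVneq dy 0; last first.
  by apply: (line dy (- dx)); [left|ring|rewrite mulNr].
rewrite {}dx0 {}dy0 in line.
have [ex0|ex0] := eqVneq ex 0; last first.
  by apply: (line ey (- ex)); [right; rewrite oppr_eq0|ring|ring].
by apply: (line 1 0); [left; rewrite oner_eq0|ring|rewrite ex0; ring].
Qed.

(** * Dimensions 3 and 6 away from the collinear locus *)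

Lemma dim_at_D_A p : (forall i, area2 p i != 0) -> dim_at (D_A R) p 3.
Proof.
move=> A0; pose B := [tuple Zfield k p | k < 3].
have BE k : B`_k = Zfield k p by rewrite -tnth_nth tnth_mktuple.
exists <<B>>%VS; split.
  move=> v; split=> [/coord_span ->|[X DX <-]].
    exists (fun q => \sum_k coord B k v *: Zfield k q).
      by apply: smooth_span_cst => k; exists k.
    by apply: eq_bigr => k _; rewrite BE.
  move: X DX; apply: smooth_span_at => _ [k _ <-].
  by rewrite -BE memv_span// mem_nth// size_tuple.
rewrite -[RHS](size_tuple B); apply/eqP/freeP => c c0 i.
have {}c0 : \sum_k c k *: Zfield k p = 0.
  by rewrite -[RHS]c0; apply: eq_bigr => k _; rewrite BE.
(* The fields act on different ants, so ant [i] sees only the term [c i]. *)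
have cx : c i * (xcoord p (ordS i) - xcoord p i) = 0.
  move/(congr1 (fun v => xcoord v i)): c0; rewrite xcoord_sum (bigD1 i)//= big1.
    by rewrite xcoordZ xcoord_Zfield eqxx mul1r addr0 => ->; rewrite /xcoord mxE.
  by move=> k ki; rewrite xcoordZ xcoord_Zfield eq_sym (negPf ki) mul0r mulr0.
have cy : c i * (ycoord p (ordS i) - ycoord p i) = 0.
  move/(congr1 (fun v => ycoord v i)): c0; rewrite ycoord_sum (bigD1 i)//= big1.
    by rewrite ycoordZ ycoord_Zfield eqxx mul1r addr0 => ->; rewrite /ycoord mxE.
  by move=> k ki; rewrite ycoordZ ycoord_Zfield eq_sym (negPf ki) mul0r mulr0.
(* [area2 p i] is linear in the edge that [c i] annihilates. *)
apply: (mulIf (A0 i)); rewrite mul0r /area2 mulrBr !mulrA cx cy; ring.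
Qed.

Lemma derived_D_A_full p v : (forall i, area2 p i != 0) ->
  exists2 X, derived_flag (D_A R) 1 X & X p = v.
Proof.
move=> A0.
pose dx i := xcoord p (ordS i) - xcoord p i.
pose dy i := ycoord p (ordS i) - ycoord p i.
(* Cramer's rule in the basis [d_i], [- d_(i+1)] of the plane of ant [i]. *)
pose c i := (dx (ordS i) * ycoord v i - dy (ordS i) * xcoord v i) / area2 p i.
pose e i := (dx i * ycoord v i - dy i * xcoord v i) / area2 p i.
exists (fun q =>
    (\sum_k e k *: lie_bracket (Zfield k) (Zfield (ordS k)) q)
    + (\sum_k c k *: Zfield k q)).
  do 2 eexists; split; last by [].
    apply: smooth_span_cst => k; exists (Zfield k), (Zfield (ordS k)).
    by split=> //; exact: D_A_Zfield.
  by apply: smooth_span_cst => k; exists k.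
(* In the plane of ant [i] both sums collapse to their term [k = i], leaving a 2 by 2 system of
   determinant [area2 p i] up to sign. *)
apply: coord_ext => i.
  rewrite xcoordD !xcoord_sum (bigD1 i)//= big1 => [|k ki]; last first.
    by rewrite xcoordZ xcoord_lie_Zfield eq_sym (negPf ki) mul0r mulr0.
  rewrite (bigD1 i)//= big1 => [|k ki]; last first.
    by rewrite xcoordZ xcoord_Zfield eq_sym (negPf ki) mul0r mulr0.
  rewrite !xcoordZ xcoord_lie_Zfield xcoord_Zfield eqxx /c /e /dx /dy /=.
  by have := A0 i; rewrite /area2 => ?; field.
rewrite ycoordD !ycoord_sum (bigD1 i)//= big1 => [|k ki]; last first.
  by rewrite ycoordZ ycoord_lie_Zfield eq_sym (negPf ki) mul0r mulr0.
rewrite (bigD1 i)//= big1 => [|k ki]; last first.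
  by rewrite ycoordZ ycoord_Zfield eq_sym (negPf ki) mul0r mulr0.
rewrite !ycoordZ ycoord_lie_Zfield ycoord_Zfield eqxx /c /e /dx /dy /=.
by have := A0 i; rewrite /area2 => ?; field.
Qed.

(** * The annihilating covectors at a collinear point *)

Lemma D_A_coords X i : D_A R X ->
  exists f : 'rV[R]_6 -> R,
    [/\ forall p j, derivable f p (delta_mx 0 j),
        forall p, xcoord (X p) i = f p * (xcoord p (ordS i) - xcoord p i) &
        forall p, ycoord (X p) i = f p * (ycoord p (ordS i) - ycoord p i)].
Proof.
move=> [m [c [V [cS VZ ->]]]].
have /choice[s sV] (k : 'I_m) : exists l, V k = Zfield l.
  by have [l _ <-] := VZ k; exists l.
(* The factor [f] collects the coefficients of all terms whose generator is [Zfield i]. *)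
exists (\sum_(k < m) (fun p => (i == s k)%:R * c k p)); split=> [p j|p|p].
- apply: derivable_sum => k.
  by apply: derivableM; [exact: derivable_cst|exact: smooth_derivable].
- rewrite xcoord_sum fct_sumE mulr_suml; apply: eq_bigr => k _.
  by rewrite sV xcoordZ xcoord_Zfield; ring.
- rewrite ycoord_sum fct_sumE mulr_suml; apply: eq_bigr => k _.
  by rewrite sV ycoordZ ycoord_Zfield; ring.
Qed.

Section CollinearPoint.
Variables (p : 'rV[R]_6) (a b c : R).
Hypothesis pL : forall i, a * xcoord p i + b * ycoord p i = c.

(** The covector [a dx_i + b dy_i], with [(a, b)] normal to the line of the ants. *)
Definition normal_part i v : R := a * xcoord v i + b * ycoord v i.

Lemma normal_part_linear i : linear (normal_part i : _ -> R^o).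
Proof.
move=> k u v; rewrite /normal_part !xcoordD !ycoordD !xcoordZ !ycoordZ.
by rewrite -[_ *: _]/(_ * _); ring.
Qed.

Lemma normal_part_D_A X i : D_A R X -> normal_part i (X p) = 0.
Proof.
move=> /(D_A_coords _ i)[f [_ fx fy]]; rewrite /normal_part fx fy.
transitivity (f p * ((a * xcoord p (ordS i) + b * ycoord p (ordS i))
                   - (a * xcoord p i + b * ycoord p i))); first by ring.
by rewrite !pL; ring.
Qed.

(* The derivative of the scalar factor of [X] drops out because it multiplies
   the normal part of [r_(i+1) - r_i], which vanishes at [p]. *)
Lemma sum_partial_D_A X v i : D_A R X ->
  (forall k, normal_part k v = 0) ->
  \sum_j v 0 j * (a * partial j (coef X (xpos i)) p
                  + b * partial j (coef X (ypos i)) p) = 0.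
Proof.
move=> /(D_A_coords _ i)[f [fd fx fy]] v0.
pose dx q := xcoord q (ordS i) - xcoord q i.
pose dy q := ycoord q (ordS i) - ycoord q i.
have dxL : linear (dx : _ -> R^o).
  by move=> k u w; rewrite /dx !xcoordD !xcoordZ -[_ *: _]/(_ * _); ring.
have dyL : linear (dy : _ -> R^o).
  by move=> k u w; rewrite /dy !ycoordD !ycoordZ -[_ *: _]/(_ * _); ring.
have Dx j : partial j (coef X (xpos i)) p
    = f p * dx (delta_mx 0 j) + dx p * partial j f p.
  have -> : coef X (xpos i) = f * dx by apply/funext => q; exact: fx.
  have H := is_derive_linear _ p (delta_mx 0 j) dxL.
  by rewrite /partial deriveM// derive_val.
have Dy j : partial j (coef X (ypos i)) p
    = f p * dy (delta_mx 0 j) + dy p * partial j f p.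
  have -> : coef X (ypos i) = f * dy by apply/funext => q; exact: fy.
  have H := is_derive_linear _ p (delta_mx 0 j) dyL.
  by rewrite /partial deriveM// derive_val.
have np0 : a * dx p + b * dy p = 0.
  by have := pL i; have := pL (ordS i); rewrite /dx /dy; lra.
(* What survives the Leibniz rule is [f p] times the derivative along [v] of the normal part of the
   edge. *)
transitivity (f p * (normal_part (ordS i) v - normal_part i v)); last first.
  by rewrite !v0 subrr mulr0.
rewrite (linear_row_coords _ _ v (normal_part_linear (ordS i))).
rewrite (linear_row_coords _ _ v (normal_part_linear i)) -sumrB mulr_sumr.
apply: eq_bigr => j _; rewrite -![_ *: _]/(_ * _) Dx Dy.
transitivity (v 0 j * (f p * (a * dx (delta_mx 0 j) + b * dy (delta_mx 0 j)))
   + v 0 j * partial j f p * (a * dx p + b * dy p)); first by ring.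
by rewrite np0 /normal_part /dx /dy; ring.
Qed.

(** The bracket is the derivative of [Y] along [X] minus that of [X] along [Y]. Both directions have
    zero normal parts at [p], so [sum_partial_D_A] applies to each. *)
Lemma normal_part_lie_bracket X Y i : D_A R X -> D_A R Y ->
  normal_part i (lie_bracket X Y p) = 0.
Proof.
move=> DX DY.
have XY := sum_partial_D_A _ _ i DY (fun k => normal_part_D_A _ k DX).
have YX := sum_partial_D_A _ _ i DX (fun k => normal_part_D_A _ k DY).
have := congr2 (fun x y : R => x - y) XY YX; rewrite /= subr0 -sumrB => <-.
rewrite /normal_part /xcoord /ycoord !mxE.
rewrite !mulr_sumr -big_split; apply: eq_bigr => j _ /=; ring.
Qed.

Lemma normal_part_derived X i : derived_flag (D_A R) 1 X ->
  normal_part i (X p) = 0.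
Proof.
move=> [Y [Z [[m [d [V [_ VC ->]]]] DZ ->]]].
have npD u v : normal_part i (u + v) = normal_part i u + normal_part i v.
  by have := normal_part_linear i 1 u v; rewrite !scale1r.
rewrite npD normal_part_D_A// addr0 /normal_part xcoord_sum ycoord_sum.
rewrite !mulr_sumr -big_split big1//= => k _.
have [A [B [DA DB VE]]] := VC k.
have := normal_part_lie_bracket _ _ i DA DB; rewrite -VE /normal_part.
rewrite xcoordZ ycoordZ => H.
by rewrite mulrCA [b * _]mulrCA -mulrDr H mulr0.
Qed.

End CollinearPoint.

Lemma collinear_not_full p :
  collinear p -> ~ dim_at (derived_flag (D_A R) 1) p 6.
Proof.
move=> [a [b [c [ab0 pL]]]] [U [UD dimU]].
have UT : U = fullv.
  by apply/eqP; rewrite eqEdim subvf dimvf dim_matrix mul1r dimU.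
(* The normal vector placed at ant 0 has normal part [a ^+ 2 + b ^+ 2], which is not zero. *)
have [X DX] := (UD (a *: delta_mx 0 (xpos 0) + b *: delta_mx 0 (ypos 0))).1
  ltac:(by rewrite UT memvf).
have := normal_part_derived _ _ _ _ pL _ 0 DX => /[swap] ->.
rewrite /normal_part /xcoord /ycoord !mxE !eqxx [ypos 0 == _]eq_sym neq_xypos /=.
rewrite !mulr0 !mulr1 addr0 add0r -!expr2 => /eqP.
rewrite paddr_eq0 ?sqr_ge0// !sqrf_eq0 => /andP[/eqP a0 /eqP b0].
by case: ab0; rewrite ?a0 ?b0 eqxx.
Qed.

(** * Assembling the growth vector *)

Lemma growth_vector_D_A p :
  ~ collinear p -> growth_vector (D_A R) p [:: 3; 6]%N.
Proof.
move=> pNL.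
have A0 i : area2 p i != 0 by apply/eqP => /collinear_area2.
exists (fun I => if I is 0 then 3 else 6)%N, 1%N; split=> //.
- case=> [|I]; first exact: dim_at_D_A.
  (* All later members of the flag contain the first derived distribution, which is already full at
     [p]. *)
  exists fullv; split; last by rewrite dimvf dim_matrix.
  move=> v; split=> [_|_]; last exact: memvf.
  have [X DX Xp] := derived_D_A_full _ v A0.
  by exists X => //; exact: derived_flag1_sub DX.
- by case.
(* Stability from 0 on would force 6 = 3. *)
- by case=> // /(_ 1%N isT).
Qed.

End Ants.

Theorem mainTheorem1 (R : realType) (p : 'rV[R]_6) :
  (growth_vector (D_A R) p [:: 3; 6]%N <-> ~ collinear p) /\
  (collinear p <->
   \sum_(i < 3) (ycoord p i * xcoord p (ordS i)
                 - xcoord p i * ycoord p (ordS i)) = 0).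
Proof.
split; last by rewrite (area2E p 0); exact: collinear_area2.
split=> [[r [K [rD _ _ rE]]] pL|]; last exact: growth_vector_D_A.
(* The length of the list fixes [K], and its second entry then gives dimension 6 for the first
   derived distribution. *)
have K1 : K = 1%N by have := congr1 size rE; rewrite size_mkseq => -[].
have := rD 1%N; move: rE; rewrite K1 => -[_ <-].
exact: collinear_not_full.
Qed.
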